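(* If $G$ is in $1$-$HNG$, then $\chi(G)$ and $\theta(G)$ can be determined in polynomial time; that is, there are algorithms that, given a graph $G$ in $1$-$HNG$, compute $\chi(G)$ and $\theta(G)$ in time polynomial in $|V(G)|$.
   Context: All graphs are finite, simple, and have at least one vertex; induced subgraphs are taken on nonempty vertex sets. $\chi$ is the chromatic number and $\theta(G)=\chi(\overline{G})$ the clique cover number. A graph $G$ is in the class $1$-$HNG$ if every induced subgraph $H$ of $G$ (including $G$ itself) satisfies $\chi(H)+\theta(H)\ge |V(H)|$. *)

(* Defs.v *)
From mathcomp Require Import all_boot.

Set Implicit Arguments.
Unset Strict Implicit.
Unset Printing Implicit Defensive.

(** * Graphs *)

Record sgraph := SGraph {
  vertex :> finType;
  adj : rel vertex;
  adj_sym : symmetric adj;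
  adj_irr : irreflexive adj }.

Section Graphs.
Variable G : sgraph.

Definition co_adj : rel G := fun x y => (x != y) && ~~ adj x y.

Lemma co_adj_sym : symmetric co_adj.
Proof. by move=> x y; rewrite /co_adj eq_sym adj_sym. Qed.

Lemma co_adj_irr : irreflexive co_adj.
Proof. by move=> x; rewrite /co_adj eqxx. Qed.

Definition complement : sgraph := SGraph co_adj_sym co_adj_irr.

Definition sub_adj (S : {set G}) : rel {x : G | x \in S} :=
  fun x y => adj (val x) (val y).

Lemma sub_adj_sym (S : {set G}) : symmetric (@sub_adj S).
Proof. by move=> x y; rewrite /sub_adj adj_sym. Qed.

Lemma sub_adj_irr (S : {set G}) : irreflexive (@sub_adj S).
Proof. by move=> x; rewrite /sub_adj adj_irr. Qed.

Definition induced (S : {set G}) : sgraph :=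
  SGraph (@sub_adj_sym S) (@sub_adj_irr S).

Definition colorable (k : nat) : bool :=
  [exists f : {ffun G -> 'I_k},
    [forall x, forall y, adj x y ==> (f x != f y)]].

Lemma colorable_ex : exists k, colorable k.
Proof.
exists #|G|; apply/existsP; exists [ffun x => enum_rank x].
apply/forallP => x; apply/forallP => y; apply/implyP => xy.
rewrite !ffunE (inj_eq enum_rank_inj).
by apply: contraTneq xy => ->; rewrite adj_irr.
Qed.

Definition chi : nat := ex_minn colorable_ex.

End Graphs.

Definition theta (G : sgraph) : nat := chi (complement G).

Definition in_1HNG (G : sgraph) : Prop :=
  forall S : {set G}, S != set0 ->
    #|induced S| <= chi (induced S) + theta (induced S).

(** * Random access machines

   The unit-cost RAM of Cook-Reckhow and Papadimitriou: registers X_0, X_1, ...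
   hold natural numbers, and the input is a word that can only be read.
   There is no multiplication, so on an input with entries of at most b bits,
   the numbers stored after t steps have at most b + t + O(1) bits, and the
   number of steps is polynomially related to the running time of a Turing
   machine. *)

Inductive instr : Type :=
| IConst of nat & nat        (* IConst i c  : X_i := c *)
| IAdd of nat & nat & nat    (* IAdd i j k  : X_i := X_j + X_k *)
| ISub of nat & nat & nat    (* ISub i j k  : X_i := X_j - X_k, truncated at 0 *)
| ILoad of nat & nat         (* ILoad i j   : X_i := X_(X_j) *)
| IStore of nat & nat        (* IStore i j  : X_(X_i) := X_j *)
| IRead of nat & nat         (* IRead i j   : X_i := input entry number X_j,
                               counted from 0; 0 past the end of the input *)
| IJump of nat & nat.        (* IJump i m   : if X_i > 0, go to instruction m *)

Definition program := seq instr.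

Record config := Config { pc : nat; reg : nat -> nat }.

Definition init : config := Config 0 (fun=> 0).

Definition upd (r : nat -> nat) (i v : nat) : nat -> nat :=
  fun k => if k == i then v else r k.

(* [step] leaves a halted configuration unchanged. *)
Definition halted (p : program) (s : config) : bool := size p <= pc s.

Definition step (p : program) (w : seq nat) (s : config) : config :=
  let: Config l r := s in
  match onth p l with
  | None => s
  | Some (IConst i c) => Config l.+1 (upd r i c)
  | Some (IAdd i j k) => Config l.+1 (upd r i (r j + r k))
  | Some (ISub i j k) => Config l.+1 (upd r i (r j - r k))
  | Some (ILoad i j) => Config l.+1 (upd r i (r (r j)))
  | Some (IStore i j) => Config l.+1 (upd r (r i) (r j))
  | Some (IRead i j) => Config l.+1 (upd r i (nth 0 w (r j)))
  | Some (IJump i m) => Config (if 0 < r i then m else l.+1) r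
  end.

Definition outputs_within (p : program) (w : seq nat) (t v : nat) : Prop :=
  exists2 u, u <= t &
    let s := iter u (step p w) init in halted p s /\ reg s 0 = v.

(** * Polynomial time on graphs *)

(* The number of vertices followed by the adjacency matrix, row by row. *)
Definition encode (G : sgraph) : seq nat :=
  #|G| :: [seq nat_of_bool (adj x y) | x <- enum G, y <- enum G].

(* The algorithm is only required to be correct, and to stop within the time
   bound, on the graphs of the class C. *)
Definition poly_time_on (C : sgraph -> Prop) (f : sgraph -> nat) : Prop :=
  exists (p : program) (c d : nat), forall G : sgraph, 0 < #|G| -> C G ->
    outputs_within p (encode G) (c * #|G| ^ d + c) (f G).

(* Main.v *)
(* Let Q be a maximum clique and J a maximum independent set of a graph G in
   1-HNG. If a triangle T avoided Q, then, by maximality of Q, Hall's condition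
   would match the vertices of T to distinct nonneighbours in Q, giving six
   vertices with chi <= 3 and theta <= 2. So G - Q is triangle-free, dually
   G - J has no independent triple, and D = V \ (Q u J) has at most 5 vertices
   as R(3,3) = 6. Moreover some threshold s on the degrees in G - D splits it
   into a clique and an independent set L.
   In a colouring of G, let the special classes be the colours used on D; each
   can be represented by at most 6 vertices outside L. Every vertex outside L
   and the special classes has a colour of its own, and one more colour serves
   all vertices of L that fit in no class so far. So "chi <= t" says that there
   are boundedly many vertices (and s) satisfying a condition that can be
   written with counting quantifiers over vertices. Closed terms with a fixed
   number of nested sums over the vertices are evaluated by a RAM in polynomial
   time, and chi is the number of t < |V| such that G is not t-colourable. *)
Require Import Defs.
From mathcomp Require Import all_boot zify.

Set Implicit Arguments.
Unset Strict Implicit.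
Unset Printing Implicit Defensive.

(** * Near-split structure *)

Section Colorings.
Variable G : sgraph.

Lemma colorableP k :
  reflect (exists f : G -> nat, (forall x, f x < k) /\
             forall x y, adj x y -> f x != f y)
          (colorable G k).
Proof.
apply: (iffP existsP) => [[f /forallP Hf]|[f [lt_f Hf]]].
  exists (fun x => nat_of_ord (f x)); split=> [x|x y xy]; first exact: ltn_ord.
  rewrite val_eqE.
  by have /forallP/(_ y)/implyP := Hf x; apply.
exists [ffun x => Ordinal (lt_f x)].
apply/forallP => x; apply/forallP => y; apply/implyP => xy.
by rewrite !ffunE -val_eqE /= Hf.
Qed.

Lemma chi_le k : (chi G <= k) = colorable G k.
Proof.
rewrite /chi; case: ex_minnP => m Hm min_m.
apply/idP/idP => [le_mk|]; last exact: min_m.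
have /colorableP[f [lt_f Hf]] := Hm.
by apply/colorableP; exists f; split=> // x; apply: leq_trans le_mk.
Qed.

Lemma chi_le_card : chi G <= #|G|.
Proof.
rewrite chi_le; apply/colorableP; exists (fun x => nat_of_ord (enum_rank x)).
split=> [x|x y xy]; first exact: ltn_ord.
rewrite val_eqE (inj_eq enum_rank_inj).
by apply: contraTneq xy => ->; rewrite adj_irr.
Qed.
End Colorings.

(* The defining inequality of 1-HNG with explicit colourings of S and of its
   complement. *)
Definition NG_bound (G : sgraph) : Prop :=
  forall (S : {set G}) (a b : nat) (f g : G -> nat), S != set0 ->
    (forall x, f x < a) -> (forall x, g x < b) ->
    {in S &, forall x y, adj x y -> f x != f y} ->
    {in S &, forall x y, x != y -> ~~ adj x y -> g x != g y} ->
  #|S| <= a + b.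

Lemma in_1HNG_bound G : in_1HNG G -> NG_bound G.
Proof.
move=> HG S a b f g S0 fa gb Hf Hg.
have <- : #|induced S| = #|S| by rewrite card_sig; apply: eq_card => x.
apply: leq_trans (HG S S0) _; apply: leq_add.
  rewrite chi_le; apply/colorableP; exists (fun x => f (val x)).
  by split=> // x y; apply: Hf; apply: valP.
rewrite /theta chi_le; apply/colorableP; exists (fun x => g (val x)).
by split=> // x y /andP[xy nxy]; apply: Hg => //; apply: valP.
Qed.

(** The two colourings exchange roles. This yields every dual statement about independent sets. *)
Lemma NG_bound_complement G : NG_bound G -> NG_bound (complement G).
Proof.
move=> HG S a b f g S0 fa gb Hf Hg; rewrite addnC.
apply: (HG S b a g f) => // x y xS yS xy.
  apply: Hg => //; last by rewrite /= /co_adj xy andbF.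
  by apply: contraTneq xy => ->; rewrite adj_irr.
by move=> nxy; apply: Hf => //; rewrite /= /co_adj xy.
Qed.

Definition clique (G : sgraph) (Q : {set G}) : bool :=
  [forall x in Q, forall y in Q, (x != y) ==> adj x y].
Definition indep (G : sgraph) (Q : {set G}) : bool :=
  [forall x in Q, forall y in Q, ~~ adj x y].

Lemma cliqueP (G : sgraph) (Q : {set G}) :
  reflect {in Q &, forall x y, x != y -> adj x y} (clique Q).
Proof.
apply: (iffP forall_inP) => [H x y xQ yQ|H x xQ].
  by have /forall_inP/(_ y yQ)/implyP := H x xQ; apply.
by apply/forall_inP => y yQ; apply/implyP; apply: H.
Qed.

Lemma indepP (G : sgraph) (Q : {set G}) :
  reflect {in Q &, forall x y, ~~ adj x y} (indep Q).
Proof.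
apply: (iffP forall_inP) => [H x y xQ yQ|H x xQ].
  by have /forall_inP/(_ y yQ) := H x xQ.
by apply/forall_inP => y yQ; apply: H.
Qed.

Lemma clique_complement (G : sgraph) (Q : {set G}) :
  @clique (complement G) Q = indep Q.
Proof.
apply/cliqueP/indepP => H x y xQ yQ.
  case: (eqVneq x y) => [->|nxy]; first by rewrite adj_irr.
  by have /andP[] := H x y xQ yQ nxy.
by move=> nxy; rewrite /= /co_adj nxy H.
Qed.

(** * Hall's theorem for two and three sets *)

Section Transversal.
Variable T : finType.
Implicit Types A B C : {set T}.

Lemma distinct_representatives2 A B :
  0 < #|A| -> 0 < #|B| -> 1 < #|A :|: B| ->
  exists x y, [/\ x \in A, y \in B & x != y].
Proof.
rewrite !card_gt0 => /set0Pn[x xA] /set0Pn[y yB] /card_gt1P[u [v [uAB vAB uv]]].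
case: (eqVneq x y) => [Exy|nxy]; last by exists x, y.
subst y; wlog ux : u v uAB vAB uv / u != x.
  move=> W; case: (eqVneq u x) => [ux|]; last exact: W uAB vAB uv.
  by apply: (W v u) => //; rewrite -?ux eq_sym.
case/setUP: uAB => uu; [by exists u, x | by exists x, u; rewrite eq_sym].
Qed.

(** If [A] has an element outside [B] and [C], it represents [A] and two sets remain. Otherwise take
    any [x] in [A]: if [B] or [C] is just the singleton of [x], that set must use [x]; if not, [x]
    can represent [A]. In each case the two remaining sets, with [x] removed, still satisfy Hall's
    condition. *)
Lemma distinct_representatives3 A B C :
  0 < #|A| -> 0 < #|B| -> 0 < #|C| ->
  1 < #|A :|: B| -> 1 < #|A :|: C| -> 1 < #|B :|: C| ->
  2 < #|A :|: B :|: C| ->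
  exists x y z, [/\ x \in A, y \in B & z \in C] /\ [/\ x != y, x != z & y != z].
Proof.
move=> A0 B0 C0 AB AC BC ABC.
have pick_first x A' B' C' : x \in A' -> 0 < #|B' :\ x| -> 0 < #|C' :\ x| ->
    1 < #|(B' :\ x) :|: (C' :\ x)| ->
    exists y z, [/\ y \in B' & z \in C'] /\ [/\ x != y, x != z & y != z].
  move=> xA' B'0 C'0 BC'.
  have [y [z [/setD1P[yx yB] /setD1P[zx zC] yz]]] :=
    distinct_representatives2 B'0 C'0 BC'.
  by exists y, z; rewrite ![x == _]eq_sym.
have rem1 x (A' : {set T}) k : k < #|A'| -> k <= #|A' :\ x|.
  by rewrite (cardsD1 x); case: (x \in A'); lia.
have sing x B' : #|B' :\ x| = 0 -> 0 < #|B'| -> B' = [set x].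
  move=> /eqP; rewrite cards_eq0 => /eqP E; rewrite card_gt0 => /set0Pn[y yB].
  have sub : B' \subset [set x] by rewrite -setD_eq0 E.
  by apply/eqP; rewrite eqEsubset sub sub1set -(set1P (subsetP sub _ yB)).
case: (boolP [exists x in A, (x \notin B :|: C)]).
  case/exists_inP => x xA; rewrite !inE negb_or => /andP[xB xC].
  have [|||y [z [[yB zC] D]]] := pick_first x A B C xA.
  - by rewrite (cardsD1 x) (negPf xB) in B0.
  - by rewrite (cardsD1 x) (negPf xC) in C0.
  - by rewrite -setDUl (setDidPl _) // disjoint_sym disjoints1 inE negb_or xB.
  by exists x, y, z.
rewrite negb_exists_in => /forall_inP AsubBC.
have {AsubBC} sub : A \subset B :|: C by apply/subsetP => x /AsubBC; rewrite negbK.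
have BC2 : 2 < #|B :|: C| by move: ABC; rewrite -setUA (setUidPr sub).
have addx x (A' : {set T}) : #|[set x] :|: A'| = #|A' :\ x|.+1.
  by rewrite cardsU1 (cardsD1 x A'); case: (x \in A').
have [x xA] : exists x, x \in A by apply/set0Pn; rewrite -card_gt0.
case: (posnP #|B :\ x|) => [/sing/(_ B0) EB|B'0].
  have [||||z [y [[zC yA] [xz xy zy]]]] := pick_first x B C A.
  - by rewrite EB set11.
  - by move: BC; rewrite EB addx.
  - by move: AB; rewrite setUC EB addx.
  - by move: ABC; rewrite -setDUl (setUC A) -setUA EB addx setUC.
  by exists y, x, z; rewrite EB set11 ![y == _]eq_sym.
case: (posnP #|C :\ x|) => [/sing/(_ C0) EC|C'0].
  have [||||z [y [[zB yA] [xz xy zy]]]] := pick_first x C B A.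
  - by rewrite EC set11.
  - by move: BC; rewrite setUC EC addx.
  - by move: AC; rewrite setUC EC addx.
  - by move: ABC; rewrite -setDUl setUC EC addx setUC.
  by exists y, z, x; rewrite EC set11 [y == z]eq_sym [y == x]eq_sym [z == x]eq_sym.
have [//|//||y [z [[yB zC] D]]] := pick_first x A B C xA.
  by rewrite -setDUl rem1.
by exists x, y, z.
Qed.
End Transversal.

Section Structure.
Variable G : sgraph.
Hypothesis HG : NG_bound G.

Lemma triangle_free_outside (Q : {set G}) x y z :
    clique Q -> (forall Q' : {set G}, clique Q' -> #|Q'| <= #|Q|) ->
    x \notin Q -> y \notin Q -> z \notin Q -> x != y -> x != z -> y != z ->
  ~~ [&& adj x y, adj x z & adj y z].
Proof.
move=> Qcl Qmax xQ yQ zQ xy xz yz; apply/negP => /and3P[axy axz ayz].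
pose N v := [set u in Q | ~~ adj v u].
(* Replacing in [Q] the set [M] of all vertices missed by some vertex of [S] by [S] itself gives a
   clique again, so maximality of [Q] forces [M] to be at least as large as [S]. *)
have hall (S : {set G}) : clique S -> [disjoint S & Q] ->
    #|S| <= #|\bigcup_(v in S) N v|.
  move=> /cliqueP Scl dis; set M := \bigcup_(v in S) N v.
  have MQ : M \subset Q
    by apply/bigcupsP => v _; apply/subsetP => u; rewrite inE => /andP[].
  have nbr u v : u \in Q :\: M -> v \in S -> adj u v.
    case/setDP => uQ uM vS; apply: contraNT uM; rewrite adj_sym => nuv.
    by apply/bigcupP; exists v; rewrite // inE uQ.
  have : clique (S :|: (Q :\: M)).
    apply/cliqueP => u v /setUP[uS|uQ] /setUP[vS|vQ] uv; first exact: Scl.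
    - by rewrite adj_sym nbr.
    - exact: nbr.
    by move/cliqueP: Qcl; apply=> //; [case/setDP: uQ | case/setDP: vQ].
  move/Qmax; rewrite cardsU (_ : S :&: _ = set0); last first.
    apply/eqP; rewrite setI_eq0; apply: disjointWr dis.
    exact: subsetDl.
  by rewrite cards0 subn0 cardsDS // ; have := subset_leq_card MQ; lia.
have cl1 (v : G) : clique [set v].
  by apply/cliqueP => a b /set1P-> /set1P->; rewrite eqxx.
have cl2 (u v : G) : adj u v -> clique [set u; v].
  move=> uv; apply/cliqueP => a b.
  by move=> /set2P[->|->] /set2P[->|->]; rewrite ?eqxx // adj_sym.
have cl3 : clique [set x; y; z].
  apply/cliqueP => a b; rewrite !inE -!orbA => /or3P[]/eqP-> /or3P[]/eqP->;
    by rewrite ?eqxx // adj_sym.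
have dis u : u \notin Q -> [disjoint [set u] & Q] by rewrite disjoints1.
have disU (S S' : {set G}) :
    [disjoint S & Q] -> [disjoint S' & Q] -> [disjoint S :|: S' & Q].
  by rewrite -!setI_eq0 setIUl => /eqP-> /eqP->; rewrite setU0.
have N1 v : v \notin Q -> 0 < #|N v|.
  by move=> vQ; have := hall _ (cl1 v) (dis v vQ); rewrite cards1 big_set1.
have N2 u v : u \notin Q -> v \notin Q -> u != v -> adj u v -> 1 < #|N u :|: N v|.
  move=> uQ vQ uv auv; have := hall _ (cl2 _ _ auv) (disU _ _ (dis u uQ) (dis v vQ)).
  by rewrite cards2 uv bigcup_setU !big_set1.
have N3 : 2 < #|N x :|: N y :|: N z|.
  have := hall _ cl3 (disU _ _ (disU _ _ (dis x xQ) (dis y yQ)) (dis z zQ)).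
  rewrite !bigcup_setU !big_set1 setUC cardsU1 cards2 !inE xy.
  by rewrite ![z == _]eq_sym (negPf xz) (negPf yz).
have [a [b [c [[]]]]] := distinct_representatives3 (N1 x xQ) (N1 y yQ) (N1 z zQ)
  (N2 x y xQ yQ xy axy) (N2 x z xQ zQ xz axz) (N2 y z yQ zQ yz ayz) N3.
rewrite !inE => /andP[aQ xa] /andP[bQ yb] /andP[cQ zc] [ab ac bc].
pose S := [set x; y; z] :|: [set a; b; c].
have S6 : #|S| = 6.
  have notQ u v : u \notin Q -> v \in Q -> (u == v) = false.
    by move=> uQ vQ; apply: contraNF uQ => /eqP->.
  rewrite /S -!setUA !cardsU1 cards1 !inE.
  by rewrite (negPf xy) (negPf xz) (negPf yz) (negPf ab) (negPf ac) (negPf bc) !notQ.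
(* The nonadjacent pairs [x a], [y b], [z c] are three colour classes. For the complement,
   membership in [Q] is a colouring with two classes: the clique [a b c] and the triangle. *)
pose f u := if u \in [set x; a] then 0 else if u \in [set y; b] then 1 else 2.
have f3 u : f u < 3 by rewrite /f; case: ifP => // _; case: ifP.
have g2 u : (u \in Q : nat) < 2 by case: (u \in Q).
have S0 : S != set0 by rewrite -card_gt0 S6.
have := HG S0 f3 g2; rewrite S6 => H; suff: 6 <= 5 by [].
apply: H => u v uS vS.
  have nonadj p q : ~~ adj p q -> u \in [set p; q] -> v \in [set p; q] -> ~~ adj u v.
    by move=> pq /set2P[->|->] /set2P[->|->]; rewrite ?adj_irr // adj_sym.
  apply: contraTneq; rewrite /f.
  have third t : t \in S -> t \notin [set x; a] -> t \notin [set y; b] ->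
      t \in [set z; c].
    rewrite !inE !negb_or => tS /andP[tx ta] /andP[ty tb].
    by move: tS; rewrite (negPf tx) (negPf ta) (negPf ty) (negPf tb).
  case: (boolP (u \in [set x; a])) => u1; case: (boolP (v \in [set x; a])) => v1 //;
    try by case: ifP.
    by move=> _; apply: nonadj xa u1 v1.
  case: (boolP (u \in [set y; b])) => u2;
    case: (boolP (v \in [set y; b])) => v2 // _.
    exact: nonadj yb u2 v2.
  by apply: nonadj zc _ _; apply: third.
move=> uv; apply: contraNneq.
have out t : t \in S -> t \notin Q -> t \in [set x; y; z].
  case/setUP => //; rewrite !inE -orbA => /or3P[]/eqP->; by rewrite ?aQ ?bQ ?cQ.
case: (boolP (u \in Q)) => uQ; case: (boolP (v \in Q)) => vQ // _.
  by move/cliqueP: Qcl; apply.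
by move/cliqueP: cl3; apply=> //; apply: out.
Qed.
End Structure.

(** By pigeonhole, three of the other vertices are related to [x] in the same way [b]. Either two of
    them are also related by [b], which completes a triple with [x], or the three form a triple of
    the opposite kind. *)
Lemma ramsey33 (G : sgraph) (D : {set G}) : 5 < #|D| ->
  exists x y z, [/\ x \in D, y \in D & z \in D] /\ [/\ x != y, x != z & y != z] /\
    ([&& adj x y, adj x z & adj y z] || [&& ~~ adj x y, ~~ adj x z & ~~ adj y z]).
Proof.
move=> D5; have [x xD] : exists x, x \in D by apply/set0Pn; rewrite -card_gt0; lia.
pose A b := [set y in D :\ x | adj x y == b].
have : 2 < #|A true| \/ 2 < #|A false|.
  have : #|D :\ x| = #|A true| + #|A false|.
    rewrite -(cardsID (A true)); congr (_ + _); apply: eq_card => y.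
      by rewrite !inE; case: (adj x y); case: (y == x); case: (y \in D).
    by rewrite !inE; case: (adj x y); case: (y == x); case: (y \in D).
  have := cardsD1 x D; rewrite xD; lia.
have key b : 2 < #|A b| -> exists x y z,
    [/\ x \in D, y \in D & z \in D] /\ [/\ x != y, x != z & y != z] /\
    ([&& adj x y, adj x z & adj y z] || [&& ~~ adj x y, ~~ adj x z & ~~ adj y z]).
  case/card_gt2P => u [v [t [[]]]]; rewrite !inE.
  move=> /andP[/andP[ux uD] /eqP xu] /andP[/andP[vx vD] /eqP xv].
  move=> /andP[/andP[tx tD] /eqP xt] [uv vt tu].
  case: (eqVneq (adj u v) b) => buv.
    exists x, u, v; rewrite xu xv buv ![x == _]eq_sym;
    by split=> //; split=> //; case: (b).
  case: (eqVneq (adj v t) b) => bvt.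
    exists x, v, t; rewrite xv xt bvt ![x == _]eq_sym;
    by split=> //; split=> //; case: (b).
  case: (eqVneq (adj u t) b) => but.
    exists x, u, t; rewrite xu xt but ![x == _]eq_sym (eq_sym u t);
    by split=> //; split=> //; case: (b).
  exists u, v, t; rewrite (eq_sym u t); split=> //; split=> //.
  by move: buv bvt but; case: (b) (adj u v) (adj v t) (adj u t) => [] [] [] [].
by case; apply: key.
Qed.

(** * Splitting by a degree threshold *)

Definition deg_outside (G : sgraph) (D : {set G}) (x : G) : nat :=
  #|[set y | (y \notin D) && adj x y]|.

Definition low (G : sgraph) (D : {set G}) (s : nat) : {set G} :=
  [set x | (x \notin D) && (deg_outside D x <= s)].

(** The bound on [s] allows it to be encoded as the rank of a vertex. *)
Definition nearly_split (G : sgraph) : Prop :=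
  exists (D : {set G}) (s : nat), [/\ #|D| <= 5, s < #|G|,
    clique [set x | (x \notin D) && (s < deg_outside D x)]
  & indep (low D s)].

(** Outside [D], a vertex of [Q] has degree at least |Q| - 1, and a vertex of [J] outside [Q] has
    degree at most |Q| - 1, since otherwise it would extend the maximum clique. Only the degree |Q|
    - 1 is ambiguous. *)
Lemma NG_bound_nearly_split (G : sgraph) :
  0 < #|G| -> NG_bound G -> nearly_split G.
Proof.
move=> G0 HG.
have maxset (P : pred {set G}) : P set0 ->
    exists2 Q, P Q & forall Q', P Q' -> #|Q'| <= #|Q|.
  by move=> P0; case: (arg_maxnP (fun Q : {set G} => #|Q|) P0) => Q; exists Q.
have [|Q Qcl Qmax] := maxset (@clique G).
  by apply/cliqueP => x y; rewrite inE.
have [|J Jind Jmax] := maxset (@indep G).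
  by apply/indepP => x y; rewrite inE.
have Q0 : 0 < #|Q|.
  have /card_gt0P[x _] := G0.
  rewrite -(cards1 x); apply: Qmax.
  by apply/cliqueP => a b /set1P-> /set1P->; rewrite eqxx.
pose D := ~: (Q :|: J).
have D5 : #|D| <= 5.
  rewrite leqNgt; apply/negP => /ramsey33[x [y [z [[]]]]].
  rewrite !inE !negb_or => /andP[xQ xJ] /andP[yQ yJ] /andP[zQ zJ].
  case=> [[xy xz yz]] /orP[]; apply/negP.
    exact: (triangle_free_outside HG) Qcl Qmax _ _ _ _ _ _.
  have := @triangle_free_outside _ (NG_bound_complement HG) J x y z.
  rewrite clique_complement /= /co_adj xy xz yz /=; apply=> // Q'.
  by rewrite clique_complement; apply: Jmax.
move/cliqueP: Qcl => Qcl; move/indepP: Jind => Jind.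
pose I := J :\: Q.
have DE x : x \notin D = (x \in Q) || (x \in I).
  by rewrite !inE negbK; case: (x \in Q).
pose nb x := [set y | (y \notin D) && adj x y].
(* [K0] contains exactly the vertices of [Q] whose degree can be as low as |Q| - 1. *)
pose K0 := [set x in Q | [forall y in I, ~~ adj x y]].
have degI x : x \in I -> nb x \subset Q :\: K0.
  move=> xI; have /setDP[xJ xQ] := xI.
  apply/subsetP => y; rewrite !inE negbK => /andP[/orP[yQ|yJ] xy].
    rewrite yQ andbT /=; apply/forall_inPn; exists x => //.
    by rewrite negbK adj_sym.
  by rewrite (negPf (Jind x y xJ yJ)) in xy.
have degQ x : x \in Q -> Q :\ x \subset nb x.
  move=> xQ; apply/subsetP => y /setD1P[yx yQ]; rewrite inE DE yQ /=.
  by rewrite Qcl // eq_sym.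
have degI_lt x : x \in I -> #|nb x| < #|Q|.
  move=> xI; have /setDP[xJ xQ] := xI.
  have sub := subset_trans (degI x xI) (subsetDl _ _).
  rewrite ltnNge; apply/negP => le.
  have Enb : nb x = Q by apply/eqP; rewrite eqEcard sub.
  have : clique (x |: Q).
    apply/cliqueP => u v /setU1P[->|uQ] /setU1P[->|vQ] uv.
    - by rewrite eqxx in uv.
    - by move: vQ; rewrite -Enb inE => /andP[].
    - by move: uQ; rewrite -Enb inE adj_sym => /andP[].
    - exact: Qcl.
  by move/Qmax; rewrite cardsU1 xQ; lia.
have degQ_ge x : x \in Q -> #|Q| <= #|nb x| + (x \in K0).
  move=> xQ; have := subset_leq_card (degQ x xQ); have := cardsD1 x Q.
  rewrite xQ [x \in K0]inE xQ /=.
  case: (boolP [forall y in I, ~~ adj x y]) => [_|]; first by lia.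
  move=> /forall_inPn[y yI]; rewrite negbK => xy Eq _.
  have : y |: (Q :\ x) \subset nb x.
    by rewrite subUset degQ // sub1set inE DE yI orbT xy.
  have /setDP[_ yQ] := yI.
  move/subset_leq_card; rewrite cardsU1 !inE (negPf yQ) andbF; lia.
have degK0 x : x \in K0 -> nb x = Q :\ x.
  rewrite inE => /andP[xQ /forall_inP xI].
  apply/eqP; rewrite eqEsubset degQ // andbT.
  apply/subsetP => y; rewrite inE DE => /andP[/orP[yQ|yI] xy].
    rewrite !inE yQ andbT; by apply: contraTneq xy => ->; rewrite adj_irr.
  by rewrite (negPf (xI y yI)) in xy.
have QG : #|Q| <= #|G| := max_card (mem Q).
have K0Q : K0 \subset Q by apply/subsetP => x; rewrite inE => /andP[].
have degE x : deg_outside D x = #|nb x| by [].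
(* If [K0] has at most one vertex, the threshold |Q| - 1 works: the low vertices lie in [I] or [K0],
   and there are no edges between these two sets. *)
case: (leqP #|K0| 1) => K01; exists D.
  exists #|Q|.-1; split=> //; first by lia.
    have hi t : t \in [set x | (x \notin D) && (#|Q|.-1 < deg_outside D x)] ->
        t \in Q.
      by rewrite in_set DE => /andP[/orP[//|/degI_lt]]; rewrite degE; lia.
    by apply/cliqueP => x y /hi xQ /hi yQ; apply: Qcl.
  have lo t : t \in low D #|Q|.-1 ->
      t \in I :|: K0.
    rewrite in_set DE in_setU => /andP[/orP[tQ|->//] dt]; apply/orP; right.
    by have := degQ_ge t tQ; move: dt; rewrite degE; case: (t \in K0) => //; lia.
  have QK t u : t \in K0 -> u \in I -> ~~ adj t u.
    by rewrite inE => /andP[_ /forall_inP H]; apply: H.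
  apply/indepP => x y /lo/setUP[] xI /lo/setUP[] yI.
  - by apply: Jind; [case/setDP: xI | case/setDP: yI].
  - by rewrite adj_sym QK.
  - exact: QK.
  - by rewrite (card_le1_eqP K01 x y xI yI) adj_irr.
(* A vertex of [I] now misses two vertices of [Q], so the threshold |Q| - 2 separates [I] from
   [Q]. *)
exists #|Q|.-2; have K0Qc := subset_leq_card K0Q.
have degI2 x : x \in I -> #|nb x| <= #|Q|.-2.
  move/degI/subset_leq_card; rewrite cardsDS //; lia.
have degQ2 x : x \in Q -> #|Q|.-2 < #|nb x|.
  by move/degQ_ge; case: (x \in K0); lia.
split=> //; first by lia.
  have hi t : t \in [set x | (x \notin D) && (#|Q|.-2 < deg_outside D x)] ->
      t \in Q.
    by rewrite in_set DE degE => /andP[/orP[//|/degI2]]; lia.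
  by apply/cliqueP => x y /hi xQ /hi yQ; apply: Qcl.
have lo t : t \in low D #|Q|.-2 -> t \in J.
  rewrite in_set DE degE => /andP[/orP[/degQ2|/setDP[//]]]; lia.
by apply/indepP => x y /lo xJ /lo yJ; apply: Jind.
Qed.

(** * Compiling arithmetic terms to random access machines *)

Inductive term : Type :=
| TConst of nat
| TVar of nat
| TAdj of nat & nat
| TAdd of term & term
| TSub of term & term
| TSum of nat & term.

(** In the [TAdj] case the successor skips the leading entry of the input, which holds the number of
    vertices. *)
Fixpoint eval (w : seq nat) (n : nat) (e : nat -> nat) (t : term) : nat :=
  match t with
  | TConst c => c
  | TVar v => e v
  | TAdj u v => nth 0 w (n * e u + e v).+1
  | TAdd a b => eval w n e a + eval w n e b
  | TSub a b => eval w n e a - eval w n e b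
  | TSum v a => \sum_(i < n) eval w n (upd e v i) a
  end.

Lemma eval_ext w n t e e' : e =1 e' -> eval w n e t = eval w n e' t.
Proof.
elim: t e e' => [c|v|u v|a IHa b IHb|a IHa b IHb|v a IHa] e e' Ee /=;
  rewrite ?Ee ?(IHa _ _ Ee) ?(IHb _ _ Ee) //.
by apply: eq_bigr => i _; apply: IHa => k; rewrite /upd Ee.
Qed.

(* Registers 0, 3 and 6 hold the constants 0, n and 1. The registers 3 v + 1
   and 3 v + 2 hold the value x of variable v and n x, so that the matrix
   can be addressed without multiplying. The registers 3 d with d > 2 form
   a stack. *)
Fixpoint compile (o d : nat) (t : term) : program :=
  match t with
  | TConst c => [:: IConst (3 * d) c]
  | TVar v => [:: IAdd (3 * d) (3 * v + 1) 0]
  | TAdj u v => [:: IAdd (3 * d) (3 * u + 2) (3 * v + 1);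
                   IAdd (3 * d) (3 * d) 6; IRead (3 * d) (3 * d)]
  | TAdd a b =>
      let ca := compile o d a in
      let cb := compile (o + size ca) d.+1 b in
      ca ++ cb ++ [:: IAdd (3 * d) (3 * d) (3 * d.+1)]
  | TSub a b =>
      let ca := compile o d a in
      let cb := compile (o + size ca) d.+1 b in
      ca ++ cb ++ [:: ISub (3 * d) (3 * d) (3 * d.+1)]
  | TSum v a =>
      [:: IConst (3 * d) 0; IAdd (3 * d.+1) (3 * v + 1) 0;
          IAdd (3 * d.+2) (3 * v + 2) 0; IConst (3 * v + 1) 0;
          IConst (3 * v + 2) 0]
      ++ compile (o + 5) d.+3 a
      ++ [:: IAdd (3 * d) (3 * d) (3 * d.+3); IAdd (3 * v + 1) (3 * v + 1) 6;
             IAdd (3 * v + 2) (3 * v + 2) 3; ISub (3 * d.+3) 3 (3 * v + 1)]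
      ++ [:: IJump (3 * d.+3) (o + 5)]
      ++ [:: IAdd (3 * v + 1) (3 * d.+1) 0; IAdd (3 * v + 2) (3 * d.+2) 0]
  end.

(** For a sum, the outer 5 counts the initialisation, the inner 5 the four updates and the jump of
    each round, and the final 2 the restoring of the variable. *)
Fixpoint cost (n : nat) (t : term) : nat :=
  match t with
  | TConst _ | TVar _ => 1
  | TAdj _ _ => 3
  | TAdd a b | TSub a b => cost n a + cost n b + 1
  | TSum _ a => 5 + n * (cost n a + 5) + 2
  end.

Lemma cost_poly t : exists c d, forall n, 0 < n -> cost n t <= c * n ^ d.
Proof.
have pos n d : 0 < n -> 0 < n ^ d by move=> n0; rewrite expn_gt0 n0.
have add (f g : nat -> nat) k :
    (exists c d, forall n, 0 < n -> f n <= c * n ^ d) ->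
    (exists c d, forall n, 0 < n -> g n <= c * n ^ d) ->
    exists c d, forall n, 0 < n -> f n + g n + k <= c * n ^ d.
  move=> [c1 [d1 H1]] [c2 [d2 H2]]; exists (c1 + c2 + k), (d1 + d2) => n n0.
  rewrite expnD !mulnDl; apply: leq_add; first apply: leq_add.
  - by rewrite mulnA (leq_trans (H1 n n0)) // leq_pmulr ?pos.
  - by rewrite mulnCA (leq_trans (H2 n n0)) // leq_pmull ?pos.
  - by rewrite leq_pmulr // muln_gt0 !pos.
elim: t => [c|v|u v|a IHa b IHb|a IHa b IHb|v a [c [d H]]] /=.
- by exists 1, 0.
- by exists 1, 0.
- by exists 3, 0.
- exact: add.
- exact: add.
(* Each sum raises the degree by one; 12 collects the constants 5, 5 and 2. *)
exists (c + 12), d.+1 => n n0; have := H n n0; have := pos _ d n0; rewrite expnS.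
set x := n ^ d; move: (cost n a) => y; nia.
Qed.

(** * Correctness and running time of the compiled code *)

Section Execution.
Variables (p : program) (w : seq nat).

Definition reach (c : nat) (s s' : config) : Prop :=
  exists2 u, u <= c & iter u (step p w) s = s'.

Lemma reach_trans c1 c2 s1 s2 s3 :
  reach c1 s1 s2 -> reach c2 s2 s3 -> reach (c1 + c2) s1 s3.
Proof.
move=> [u1 le1 <-] [u2 le2 <-]; exists (u2 + u1); first by lia.
by rewrite iterD.
Qed.

Lemma reach_le c1 c2 s s' : c1 <= c2 -> reach c1 s s' -> reach c2 s s'.
Proof. by move=> le12 [u le_u <-]; exists u; first exact: leq_trans le12. Qed.

Lemma reach0 s : reach 0 s s. Proof. by exists 0. Qed.

Definition is_jump (i : instr) : bool :=
  if i is IJump _ _ then true else false.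

Definition effect (r : nat -> nat) (i : instr) : nat -> nat :=
  match i with
  | IConst i c => upd r i c
  | IAdd i j k => upd r i (r j + r k)
  | ISub i j k => upd r i (r j - r k)
  | ILoad i j => upd r i (r (r j))
  | IStore i j => upd r (r i) (r j)
  | IRead i j => upd r i (nth 0 w (r j))
  | IJump _ _ => r
  end.

Lemma onth_cat_cons (p1 p2 : program) i : onth (p1 ++ i :: p2) (size p1) = Some i.
Proof. by elim: p1. Qed.

Lemma reach_block p1 b p2 r : p = p1 ++ b ++ p2 -> all (predC is_jump) b ->
  reach (size b) (Config (size p1) r)
        (Config (size p1 + size b) (foldl effect r b)).
Proof.
elim: b p1 r => [|i b IHb] p1 r /= Ep; first by rewrite addn0 => _; apply: reach0.
case/andP => Hi Hb; rewrite -add1n.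
apply: (@reach_trans _ _ _ (Config (size p1).+1 (effect r i))).
  by exists 1; rewrite //= Ep onth_cat_cons; case: i Hi {Ep}.
rewrite addnA addn1 -(size_rcons p1 i); apply: IHb => //.
by rewrite Ep -cats1 -catA.
Qed.

Lemma reach_jump p1 p2 i m r : p = p1 ++ [:: IJump i m] ++ p2 ->
  reach 1 (Config (size p1) r) (Config (if 0 < r i then m else (size p1).+1) r).
Proof. by move=> Ep; exists 1; rewrite //= Ep onth_cat_cons. Qed.

Definition represents (n : nat) (e : nat -> nat) (r : nat -> nat) : Prop :=
  [/\ r 0 = 0, r 3 = n, r 6 = 1
    & forall v, r (3 * v + 1) = e v /\ r (3 * v + 2) = n * e v].

(** Code at depth [d] must leave intact the registers of the variables, which are those not
    divisible by 3, and the constants and the stack below depth [d]. *)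
Definition preserved (d : nat) (r r' : nat -> nat) : Prop :=
  forall k, (k %% 3 != 0) || (k < 3 * d) -> r' k = r k.

Lemma preserved_represents n e d r r' :
  2 < d -> preserved d r r' -> represents n e r -> represents n e r'.
Proof.
move=> d2 P [r0 r3 r6 rv].
split; try (rewrite P //; lia).
by move=> v; rewrite !P; [exact: rv|lia|lia].
Qed.


Ltac upd_tac := rewrite /upd; repeat (case: eqP => ?; try lia).

(** The code sits at an arbitrary place of the program because jump targets are absolute. *)
Definition compiles n t : Prop := forall p1 p2 d e r,
  2 < d -> p = p1 ++ compile (size p1) d t ++ p2 -> represents n e r ->
  exists r', [/\ reach (cost n t) (Config (size p1) r)
      (Config (size p1 + size (compile (size p1) d t)) r'),
    r' (3 * d) = eval w n e t & preserved d r r'].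

(** Treats addition and subtraction together. The second operand is evaluated one stack position
    higher, which protects the value of the first. *)
Lemma compiles_binary n a b f p1 p2 d e r i :
    compiles n a -> compiles n b -> ~~ is_jump i ->
    (forall r, effect r i = upd r (3 * d) (f (r (3 * d)) (r (3 * d.+1)))) ->
    2 < d ->
    let ca := compile (size p1) d a in
    let cb := compile (size p1 + size ca) d.+1 b in
    p = p1 ++ (ca ++ cb ++ [:: i]) ++ p2 -> represents n e r ->
  exists r', [/\ reach (cost n a + cost n b + 1) (Config (size p1) r)
      (Config (size p1 + size (ca ++ cb ++ [:: i])) r'),
    r' (3 * d) = f (eval w n e a) (eval w n e b) & preserved d r r'].
Proof.
move=> IHa IHb ji Hi d2 ca cb Ep Rr.
have [|ra [Ra va Pa]] := IHa p1 (cb ++ [:: i] ++ p2) d e r d2 _ Rr.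
  by rewrite Ep -!catA.
have Rra := preserved_represents d2 Pa Rr.
have sz1 : size (p1 ++ ca) = size p1 + size ca by rewrite size_cat.
have [||rb [Rb vb Pb]] := IHb (p1 ++ ca) ([:: i] ++ p2) d.+1 e ra _ _ Rra.
- by lia.
- by rewrite Ep sz1 -!catA.
rewrite sz1 -/cb in Rb.
have := @reach_block (p1 ++ ca ++ cb) [:: i] p2 rb.
rewrite Ep -!catA /= andbT => /(_ erefl ji) Rc.
exists (upd rb (3 * d) (f (rb (3 * d)) (rb (3 * d.+1)))); split.
- apply: reach_trans (reach_trans Ra Rb) _.
  move: Rc; rewrite Hi !size_cat /= !addnA; exact.
- rewrite /upd eqxx; congr f => //.
  by rewrite Pb ?va //; lia.
- move=> k Hk; rewrite -Pa // -[ra k]Pb; last by lia.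
  by upd_tac.
Qed.

(** The body runs before the jump is tested, so the loop makes at least one round; this is where [n]
    must be positive. The test register holds [n] minus the number of completed rounds. *)
Lemma compiles_sum n v a : 0 < n -> compiles n a -> compiles n (TSum v a).
Proof.
move=> n0 IHa p1 p2 d e r d2; cbn [compile cost eval].
set b1 := [:: IConst _ _; _; _; _; _].
set ca := compile _ _ a; set b2 := [:: _; _; _; _]; set b3 := [:: _; _].
set j := [:: IJump _ _]; set o := size p1 => Ep Rr.
(* Invariant after [i] rounds: the partial sum is at depth [d], and the outer values for [v] are
   saved at the next two depths, to be restored after the loop. Hence only the two registers of [v]
   are exempt from preservation. *)
pose inv i r' := [/\ r' (3 * d) = \sum_(k < i) eval w n (upd e v k) a,
  r' (3 * d.+1) = e v, r' (3 * d.+2) = n * e v, represents n (upd e v i) r'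
  & forall k, k != 3 * v + 1 -> k != 3 * v + 2 ->
      (k %% 3 != 0) || (k < 3 * d) -> r' k = r k].
have [r0 r3 r6 Rv] := Rr.
have start : exists2 r1, reach 5 (Config o r) (Config (o + 5) r1) & inv 0 r1.
  have Eb : p = p1 ++ b1 ++ (ca ++ b2 ++ j ++ b3 ++ p2).
    by rewrite Ep -!catA.
  eexists; first exact: (reach_block r Eb erefl).
  have [e1 e2] := Rv v.
  rewrite /= /inv big_ord0; split=> /=; try by upd_tac.
    split; try by upd_tac.
    by move=> u; have [? ?] := Rv u; split; upd_tac.
  by move=> k k1 k2 Hk; upd_tac.
have loop i r1 : i < n -> inv i r1 ->
    exists2 r2, reach (cost n a + 5) (Config (o + 5) r1)
      (Config (if i.+1 < n then o + 5 else o + 5 + size ca + 5) r2)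
    & inv i.+1 r2.
  move=> lt_in [acc s1 s2 R1 P1].
  have szb : size (p1 ++ b1) = o + 5 by rewrite size_cat.
  have [||r2 [R2 v2 P2]] :=
    IHa (p1 ++ b1) (b2 ++ j ++ b3 ++ p2) d.+3 (upd e v i) r1 _ _ R1.
  - by lia.
  - by rewrite Ep szb -!catA.
  rewrite szb -/ca in R2.
  have Eb : p = (p1 ++ b1 ++ ca) ++ b2 ++ (j ++ b3 ++ p2).
    by rewrite Ep -!catA.
  have := reach_block r2 Eb erefl.
  have -> : size (p1 ++ b1 ++ ca) = o + 5 + size ca by rewrite !size_cat addnA.
  set r3' := foldl _ _ _ => R3.
  have Ej : p = (p1 ++ b1 ++ ca ++ b2) ++ j ++ (b3 ++ p2).
    by rewrite Ep -!catA.
  have := reach_jump r3' Ej.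
  have -> : size (p1 ++ b1 ++ ca ++ b2) = o + 5 + size ca + 4.
    by rewrite !size_cat /=; lia.
  have d5 : 2 < d.+3 by lia.
  have [q0 q3 q6 qv] := preserved_represents d5 P2 R1.
  have [w1 w2] := qv v; rewrite /upd eqxx in w1 w2.
  move=> R4; exists r3'.
    have Ec : r3' (3 * d.+3) = n - i.+1 by rewrite /r3' /=; upd_tac.
    have := reach_trans (reach_trans R2 R3) R4.
    rewrite Ec subn_gt0; case: ifP => _; rewrite ?addn1 -?addnS => H;
      by apply: reach_le H; rewrite /=; lia.
  have t0 : r2 (3 * d) = r1 (3 * d) by apply: P2; lia.
  have t1 : r2 (3 * d.+1) = r1 (3 * d.+1) by apply: P2; lia.
  have t2 : r2 (3 * d.+2) = r1 (3 * d.+2) by apply: P2; lia.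
  rewrite /r3' /inv big_ord_recr /= -v2 -acc -t0; split=> /=; try by upd_tac.
    split; try by upd_tac.
    move=> u; have := qv u; rewrite /upd; case: (u =P v) => [-> _|Nu [<- <-]].
      by split; upd_tac.
    by split; upd_tac.
  move=> k k1 k2 Hk; rewrite -P1 // -[r1 k]P2; last by lia.
  by upd_tac.
have iter_loop m i r1 : i + m.+1 = n -> inv i r1 ->
    exists2 r2, reach (m.+1 * (cost n a + 5)) (Config (o + 5) r1)
      (Config (o + 5 + size ca + 5) r2) & inv n r2.
  elim: m i r1 => [|m IHm] i r1 Ei I1.
    have [|r2 R2 I2] := loop i r1 _ I1; first by lia.
    exists r2; last by rewrite (_ : n = i.+1); [| lia].
    by move: R2; rewrite ifF ?mul1n //; lia.
  have [|r2 R2 I2] := loop i r1 _ I1; first by lia.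
  rewrite ifT in R2; last by lia.
  have [|r3' R3 I3] := IHm i.+1 r2 _ I2; first by lia.
  by exists r3' => //; rewrite mulSn; apply: reach_trans R2 R3.
have [r1 R1 I1] := start.
have [|r2 R2 [acc s1 s2 [q0 q3 q6 qv] P2]] := iter_loop n.-1 0 r1 _ I1.
  by rewrite prednK.
rewrite prednK // in R2.
have Eb : p = (p1 ++ b1 ++ ca ++ b2 ++ j) ++ b3 ++ p2.
  by rewrite Ep -!catA.
have := reach_block r2 Eb erefl.
have -> : size (p1 ++ b1 ++ ca ++ b2 ++ j) = o + 5 + size ca + 5.
  by rewrite !size_cat /=; lia.
set r3' := foldl _ _ _ => R3; exists r3'; split.
- have := reach_trans (reach_trans R1 R2) R3; rewrite /= !size_cat /=.
  by have -> : o + 5 + size ca + 5 + 2 =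
    o + (size ca + 7).+1.+4 by lia.
- by rewrite /r3' /=; upd_tac.
have [e1 e2] := Rv v.
move=> k Hk; rewrite /r3' /= /upd; case: eqP => [->|/eqP k2]; first by rewrite e2; upd_tac.
case: eqP => [->|/eqP k1]; first by rewrite e1 s1 q0 addn0.
by rewrite P2.
Qed.

Lemma compile_correct n t : 0 < n -> compiles n t.
Proof.
move=> n0; elim: t => [c|v|u v|a IHa b IHb|a IHa b IHb|v a IHa];
  last exact: compiles_sum; move=> p1 p2 d e r d2 Ep Rr.
- exists (upd r (3 * d) c); split; first exact: (reach_block r Ep).
    by rewrite /upd eqxx.
  by move=> k Hk; upd_tac.
- exists (upd r (3 * d) (r (3 * v + 1) + r 0)); split; first exact: (reach_block r Ep).
    by case: Rr => -> _ _ Rv; rewrite /upd eqxx addn0; case: (Rv v).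
  by move=> k Hk; upd_tac.
- eexists; split; first exact: (reach_block r Ep).
    case: Rr => r0 r3 r6 Rv /=.
    have [_ Ru] := Rv u; have [{}Rv _] := Rv v.
    have -> x : upd r (3 * d) x 6 = 1 by upd_tac.
    by rewrite /upd eqxx Rv Ru addn1.
  by move=> k Hk /=; upd_tac.
- by apply: (compiles_binary (f := addn)) Ep Rr.
- by apply: (compiles_binary (f := subn)) Ep Rr.
Qed.

End Execution.

(** All registers start at 0, so the first instruction reads input entry 0, the number of vertices.
    Code at depth 3 leaves its value in register 9, which is copied to the output register. *)
Definition term_program (t : term) : program :=
  [:: IRead 3 0; IConst 6 1] ++ compile 2 3 t ++ [:: IAdd 0 9 0].

Lemma term_program_correct t : exists c d, forall n s, 0 < n ->
  outputs_within (term_program t) (n :: s) (c * n ^ d + c)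
    (eval (n :: s) n (fun=> 0) t).
Proof.
(* The 3 pays for the three instructions around the compiled code. *)
have [c [d Hcost]] := cost_poly t; exists (c + 3), d => n s n0.
set w := n :: s; set p := term_program t.
have R1 := @reach_block p w [::] [:: IRead 3 0; IConst 6 1] _ (reg init) erefl erefl.
set r1 := foldl _ _ _ in R1.
have Rr : represents n (fun=> 0) r1.
  split=> // v; rewrite /r1 /= /upd muln0.
  by split; repeat (case: eqP => ?; try lia).
have [//|//|r2 [R2 v2 P2]] := @compile_correct p w n t n0
  [:: IRead 3 0; IConst 6 1] [:: IAdd 0 9 0] 3 _ r1 _ _ Rr.
have Ep : p = ([:: IRead 3 0; IConst 6 1] ++ compile 2 3 t) ++ [:: IAdd 0 9 0] ++ [::].
  by rewrite cats0 -catA.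
have R3 := reach_block w r2 Ep erefl.
rewrite size_cat in R3.
have [u le_u Eu] := reach_trans (reach_trans R1 R2) R3.
exists u; first by have := Hcost n n0; move: le_u => /=; nia.
rewrite -[init]/(Config 0 (reg init)) Eu; split.
  by rewrite /halted /= !size_cat /=; lia.
rewrite /= /upd eqxx v2.
by have [-> _ _ _] := preserved_represents (isT : 2 < 3) P2 Rr; rewrite addn0.
Qed.

(** * Terms evaluated on graphs *)

Lemma nth_allpairs (S T R : Type) (f : S -> T -> R) x0 y0 z0 s t i j :
  i < size s -> j < size t ->
  nth z0 [seq f x y | x <- s, y <- t] (size t * i + j) = f (nth x0 s i) (nth y0 t j).
Proof.
elim: s i => // x s IHs [|i] lt_i lt_j; rewrite allpairs_cons nth_cat size_map.
  by rewrite muln0 add0n lt_j (nth_map y0).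
rewrite ifN; last by rewrite -leqNgt; nia.
by rewrite (_ : _ - _ = size t * i + j) ?IHs //; nia.
Qed.

Lemma nth_encode (G : sgraph) (x y : G) :
  nth 0 (encode G) (#|G| * enum_rank x + enum_rank y).+1 = adj x y.
Proof.
rewrite /encode [LHS]/= [X in X * _](cardE G) (nth_allpairs _ x x).
- by rewrite -!(enum_val_nth x) !enum_rankK.
- by rewrite -cardE.
- by rewrite -cardE.
Qed.

Section GraphTerms.

Definition assign (T : Type) (e : nat -> T) (v : nat) (x : T) : nat -> T :=
  fun k => if k == v then x else e k.

Variable G : sgraph.
Implicit Types (e : nat -> G) (a b : term).

(** Vertices enter as their ranks, so a variable can stand for a vertex or for a number below
    |G|. *)
Definition gval e a : nat := eval (encode G) #|G| (fun v => enum_rank (e v)) a.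

(** With positivity as truth, sums act as disjunctions and existential quantifiers, and truncated
    subtraction gives negation and comparison. *)
Definition holds e a : bool := 0 < gval e a.

Lemma gval_sum e v a : gval e (TSum v a) = \sum_(x : G) gval (assign e v x) a.
Proof.
rewrite /gval /= (reindex (@enum_rank G)) /=; last exact/onW_bij/enum_rank_bij.
apply: eq_bigr => x _; apply: eval_ext => k.
by rewrite /upd /assign; case: eqP.
Qed.

Lemma gval_adj e u v : gval e (TAdj u v) = adj (e u) (e v).
Proof. exact: nth_encode. Qed.

Lemma holds_adj e u v : holds e (TAdj u v) = adj (e u) (e v).
Proof. by rewrite /holds gval_adj; case: adj. Qed.

End GraphTerms.

(** * Connectives and counting quantifiers as terms *)

Definition tNot a := TSub (TConst 1) a.
Definition tAnd a b := tNot (TAdd (tNot a) (tNot b)).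
Definition tLe a b := tNot (TSub a b).
Definition tEq u v := tAnd (tLe (TVar u) (TVar v)) (tLe (TVar v) (TVar u)).
(** The double negation reduces every positive value to 1. *)
Definition tCount v a := TSum v (tNot (tNot a)).
Definition tHas (f : nat -> term) (k : nat) : term :=
  foldr TAdd (TConst 0) [seq f i | i <- iota 0 k].
Definition tExs (vs : seq nat) (a : term) : term := foldr TSum a vs.

Section Connectives.
Variable G : sgraph.
Implicit Types (e : nat -> G) (a b : term).

Lemma gval_not e a : gval e (tNot a) = ~~ holds e a.
Proof. by rewrite /holds /gval /=; case: (eval _ _ _ a) => [|[|n]]. Qed.

Lemma holds_not e a : holds e (tNot a) = ~~ holds e a.
Proof. by rewrite /holds gval_not; rewrite lt0b. Qed.

Lemma holds_add e a b : holds e (TAdd a b) = holds e a || holds e b.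
Proof. by rewrite /holds /gval /= addn_gt0. Qed.

Lemma holds_and e a b : holds e (tAnd a b) = holds e a && holds e b.
Proof. by rewrite holds_not holds_add !holds_not negb_or !negbK. Qed.

Lemma holds_le e a b : holds e (tLe a b) = (gval e a <= gval e b).
Proof. by rewrite holds_not /holds /gval /= subn_gt0 -leqNgt. Qed.

Lemma holds_eq e u v : holds e (tEq u v) = (e u == e v).
Proof.
by rewrite holds_and !holds_le /gval /= -eqn_leq val_eqE (inj_eq enum_rank_inj).
Qed.

Lemma holds_sum e v a : holds e (TSum v a) = [exists x, holds (assign e v x) a].
Proof.
rewrite /holds gval_sum lt0n sum_nat_eq0 negb_forall.
by apply: eq_existsb => x; rewrite /= -lt0n.
Qed.

Lemma gval_count e v a :
  gval e (tCount v a) = #|[set x | holds (assign e v x) a]|.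
Proof.
rewrite gval_sum -sum1_card [RHS]big_mkcond; apply: eq_bigr => x _.
by rewrite gval_not holds_not negbK inE; case: (holds _ _).
Qed.

Lemma holds_has e f k : holds e (tHas f k) = has (fun i => holds e (f i)) (iota 0 k).
Proof. by rewrite /tHas; elim: (iota 0 k) => //= i s IHs; rewrite holds_add IHs. Qed.

Lemma holds_exs e vs a :
  holds e (tExs vs a) <->
  exists e', (forall v, v \notin vs -> e' v = e v) /\ holds e' a.
Proof.
elim: vs e => [|u vs IHvs] e /=.
  split=> [H|[e' [Ee H]]]; first by exists e.
  rewrite /holds /gval (@eval_ext _ _ _ _ (fun v => enum_rank (e' v))) // => v.
  by rewrite Ee.
rewrite holds_sum; split=> [/existsP[x /IHvs[e' [Ee H]]]|[e' [Ee H]]].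
  exists e'; split=> // v; rewrite inE negb_or => /andP[vu vvs].
  by rewrite Ee // /assign (negPf vu).
apply/existsP; exists (e' u); apply/IHvs; exists e'; split=> // v vvs.
rewrite /assign; case: eqP => [->//|/eqP vu].
by rewrite Ee // inE negb_or vu.
Qed.

End Connectives.

(** Makes a term about the complement computable from the encoding of the graph itself; this reduces
    [theta] to [chi]. *)
Fixpoint complement_term (a : term) : term :=
  match a with
  | TAdj u v => tNot (TAdd (TAdj u v) (tEq u v))
  | TAdd a b => TAdd (complement_term a) (complement_term b)
  | TSub a b => TSub (complement_term a) (complement_term b)
  | TSum v a => TSum v (complement_term a)
  | _ => a
  end.

Lemma gval_complement (G : sgraph) (e : nat -> G) a :
  @gval G e (complement_term a) = @gval (complement G) e a.
Proof.
elim: a e => [c|v|u v|a IHa b IHb|a IHa b IHb|v a IHa] e //.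
- rewrite [complement_term _]/= gval_not holds_add holds_eq holds_adj gval_adj.
  by rewrite /= /co_adj negb_or andbC.
- by rewrite /gval /=; congr (_ + _); [apply: IHa | apply: IHb].
- by rewrite /gval /=; congr (_ - _); [apply: IHa | apply: IHb].
- by rewrite /= !gval_sum; apply: eq_bigr => x _; apply: IHa.
Qed.

Lemma poly_time_term (C : sgraph -> Prop) (f : sgraph -> nat) (a : term) :
  (forall (G : sgraph) (e : nat -> G), C G -> gval e a = f G) ->
  poly_time_on C f.
Proof.
move=> Ha; have [c [d H]] := term_program_correct a.
exists (term_program a), c, d => G G0 CG.
have := H _ [seq nat_of_bool (adj x y) | x <- enum G, y <- enum G] G0.
have -> // : eval (encode G) #|G| (fun=> 0) a = f G.
(* The vertex of rank 0 matches the initial environment, in which all variables are 0. *)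
rewrite -(Ha G (fun=> enum_val (Ordinal G0)) CG); apply: eval_ext => v.
by rewrite enum_valK.
Qed.

(** * Colourings *)

Section SpecialColoring.
Variable G : sgraph.

(** Cores may overlap. A vertex in some core takes the colour of such a core; any other vertex lies
    in [L] and takes a colour whose core it does not meet. Two vertices of [L] sharing a colour in
    this way are harmless, as [L] is independent. *)
Lemma colorable_of_cores (T : nat) (core : nat -> {set G}) (L : {set G}) :
    (forall c, c < T -> indep (core c)) -> indep L ->
    (forall z, (exists2 c, c < T & z \in core c) \/
       z \in L /\ (exists2 c, c < T & forall y, y \in core c -> ~~ adj z y)) ->
  colorable G T.
Proof.
move=> Hcore /indepP HL Hz.
pose good z (c : 'I_T) := if [exists c' : 'I_T, z \in core c'] then z \in core c
  else (z \in L) && [forall y in core c, ~~ adj z y].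
have [f Hf] : exists f, forall z, good z (f z).
  apply: (@fin_all_exists _ (fun=> 'I_T) (fun z c => good z c)) => z.
  rewrite /good; case: (boolP [exists c : 'I_T, z \in core c]) => [/existsP//|].
  rewrite negb_exists => /forallP Hno.
  have [[c ltc zc]|[zL [c ltc H]]] := Hz z.
    by have := Hno (Ordinal ltc); rewrite zc.
  by exists (Ordinal ltc); rewrite zL; apply/forall_inP.
apply/colorableP; exists (fun z => f z); split=> [//|x y].
apply: contraTneq => /val_inj Ef.
have := Hf x; have := Hf y; rewrite /good -Ef.
case: ifP => _; last move=> /andP[yL /forall_inP Hy].
  case: ifP => _ yc.
    by move=> xc; move/indepP: (Hcore _ (ltn_ord (f x))); apply.
  by case/andP=> _ /forall_inP; apply.
case: ifP => _; first by rewrite adj_sym; apply: Hy.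
by case/andP=> xL _; apply: HL.
Qed.

Variables (k : nat) (X : nat -> {set G}) (L : {set G}).

Definition special : {set G} := [set z | has (fun i => z \in X i) (iota 0 k)].
Definition single : {set G} := ~: (special :|: L).
Definition stuck : {set G} :=
  [set z | [&& z \in L, z \notin special,
     all (fun i => [exists y, (y \in X i) && adj z y]) (iota 0 k)
     & [forall y in single, adj z y]]].

(* The classes X i, a class for each vertex of [single], and one more for the
   stuck vertices; the other vertices of L join some class. *)
Definition special_coloring (t : nat) : bool :=
  [&& all (fun i => indep (X i)) (iota 0 k), indep L
    & k + #|single| + (stuck != set0) <= t].

Lemma special_coloring_colorable t : special_coloring t -> colorable G t.
Proof.
case/and3P => /allP Xind Lind; set T := k + _ + _ => le_t.
suff : colorable G T.
  by rewrite -!chi_le => H; apply: leq_trans le_t.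
have [z0|noz] := pickP G; last first.
  apply: (@colorable_of_cores T (fun=> set0) set0) => [c _||z].
  - by apply/indepP => x; rewrite inE.
  - by apply/indepP => x; rewrite inE.
  - by have := noz z.
move=> _.
(* The first [k] colours belong to the special classes and the next ones to single vertices. A
   further colour, present only if some vertex is stuck, has an empty core and so accepts all of
   them. *)
pose core c := if c < k then X c else
  if c < k + #|single| then [set nth z0 (enum single) (c - k)] else set0.
apply: (@colorable_of_cores T core L) => // [c ltc|z].
  rewrite /core; case: ifP => [ck|_]; first by apply: Xind; rewrite mem_iota.
  case: ifP => _; apply/indepP => x y; rewrite !inE //.
  by move=> /eqP-> /eqP->; rewrite adj_irr.
have core_single y : y \in single -> exists2 c, c < T & core c = [set y].
  move=> yS; have lti : index y (enum single) < #|single|.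
    by rewrite cardE index_mem mem_enum.
  exists (k + index y (enum single)); first by rewrite /T; lia.
  rewrite /core ifF ?ltn_add2l; last by lia.
  by rewrite lti addKn nth_index ?mem_enum.
case: (boolP (z \in special)) => [|zX].
  rewrite inE => /hasP[i]; rewrite mem_iota => /= ik zi.
  by left; exists i; [rewrite /T; lia | rewrite /core ik].
case: (boolP (z \in L)) => [zL|zL]; last first.
  left; have [|c ltc Ec] := core_single z.
    by rewrite in_setC in_setU negb_or zX zL.
  by exists c; rewrite // Ec set11.
right; split=> //.
case: (boolP (all (fun i => [exists y, (y \in X i) && adj z y]) (iota 0 k))); last first.
  case/allPn => i; rewrite mem_iota => /= ik; rewrite negb_exists => /forallP Hi.
  exists i; first by rewrite /T; lia.
  by rewrite /core ik => y yi; have := Hi y; rewrite yi.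
move=> Hall; case: (boolP [forall y in single, adj z y]); last first.
  case/forall_inPn => y yS zy; have [c ltc Ec] := core_single y yS.
  by exists c => // u; rewrite Ec => /set1P->.
move=> Hsingle; have stuck0 : stuck != set0.
  by apply/set0Pn; exists z; rewrite inE zL zX Hall.
exists (k + #|single|); first by rewrite /T stuck0; lia.
by rewrite /core ltnNge leq_addr ltnn => y; rewrite inE.
Qed.

End SpecialColoring.

Lemma colorable_special (G : sgraph) (D : {set G}) (s t : nat) :
    #|D| <= 5 -> clique [set x | (x \notin D) && (s < deg_outside D x)] ->
    indep (low D s) -> colorable G t ->
  exists k (X : nat -> {set G}), [/\ k <= 5,
    forall i, i < k -> 0 < #|X i| <= 6 & special_coloring k X (low D s) t].
Proof.
move=> D5 /cliqueP Hcl Lind /colorableP[f [lt_f Hf]].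
set H := [set x | _] in Hcl; set L := low D s in Lind *.
(* [cs] lists the colours occurring on [D]; the class [X i] is the part of the [i]-th colour outside
   [L]. *)
pose cs := undup [seq f d | d <- enum D]; pose k := size cs.
pose X i := [set z in D :|: H | f z == nth 0 cs i].
have cs_mem c : reflect (exists2 d, d \in D & c = f d) (c \in cs).
  rewrite mem_undup; apply: (iffP mapP) => [[d]|[d]].
    by rewrite mem_enum; exists d.
  by exists d; rewrite ?mem_enum.
have k5 : k <= 5.
  by apply: leq_trans (size_undup _) _; rewrite size_map -cardE.
have specialP z : z \in D :|: H -> (z \in special k X) = (f z \in cs).
  move=> zDH; rewrite inE; apply/hasP/idP => [[i]|fz].
    by rewrite mem_iota => ik; rewrite inE => /andP[_ /eqP->]; apply: mem_nth.
  exists (index (f z) cs); first by rewrite mem_iota index_mem.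
  by rewrite inE zDH nth_index ?eqxx.
have singleP z : z \in single k X L -> z \in H /\ f z \notin cs.
  rewrite in_setC in_setU negb_or => /andP[zX zL].
  have zD : z \notin D.
    apply: contra zX => zD; rewrite specialP ?inE ?zD //.
    by apply/cs_mem; exists z.
  have zH : z \in H by move: zL; rewrite !inE zD /= ltnNge.
  by split=> //; rewrite -specialP // inE zH orbT.
exists k, X; split=> // [i ik|].
  have /cs_mem[d dD Ed] := mem_nth 0 ik.
  apply/andP; split; first by apply/card_gt0P; exists d; rewrite !inE dD Ed eqxx.
  (* At most five vertices come from [D] and at most one from the clique [H]. *)
  have sub : X i \subset D :|: (X i :\: D).
    by apply/subsetP => z zX; rewrite in_setU in_setD zX andbT; case: (z \in D).
  apply: leq_trans (subset_leq_card sub) _.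
  apply: leq_trans (leq_card_setU _ _) _; rewrite -[6]/(5 + 1) leq_add //.
  apply/card_le1_eqP => x y; rewrite !inE.
  move=> /andP[xD /andP[xDH /eqP fx]] /andP[yD /andP[yDH /eqP fy]].
  apply/eqP; apply: contraTT isT => xy.
  have ayx : adj y x.
    apply: (Hcl y x) => //; first by move: yDH; rewrite inE (negPf yD).
    by move: xDH; rewrite inE (negPf xD).
  by have := Hf y x ayx; rewrite fx fy eqxx.
apply/and3P; split=> //.
  apply/allP => i _; apply/indepP => x y; rewrite !inE.
  move=> /andP[_ /eqP fx] /andP[_ /eqP fy].
  by apply: contraTN isT => /Hf; rewrite fx fy eqxx.
(* The colours of the single vertices are distinct, since these lie in the clique [H], and differ
   from those in [cs]. *)
pose rs := [seq f z | z <- enum (single k X L)].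
have uniq_rs : uniq (cs ++ rs).
  rewrite cat_uniq undup_uniq /=; apply/andP; split.
    apply/hasPn => c /mapP[z]; rewrite mem_enum => /singleP[_ zc] ->.
    exact: zc.
  rewrite map_inj_in_uniq ?enum_uniq // => x y; rewrite !mem_enum.
  move=> /singleP[xH _] /singleP[yH _] fxy; apply/eqP.
  by apply: contraTT isT => xy; have := Hf x y (Hcl x y xH yH xy); rewrite fxy eqxx.
have size_rs : size (cs ++ rs) = k + #|single k X L|.
  by rewrite size_cat size_map -cardE.
have in_t c : c \in cs ++ rs -> c \in iota 0 t.
  rewrite mem_cat mem_iota => /orP[/cs_mem[d _ ->]|/mapP[z _ ->]]; exact: lt_f.
rewrite -size_rs; case: (set0Pn _) => [[z]|_]; last first.
  by rewrite addn0 -(size_iota 0 t); apply: uniq_leq_size.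
(* A stuck vertex has a neighbour of every colour in [cs] and [rs], so its own colour is one
   more. *)
rewrite inE => /and4P[_ zX /allP Hi /forall_inP Hs].
rewrite addn1 -(size_iota 0 t) -[_.+1]/(size (f z :: cs ++ rs)).
apply: uniq_leq_size => [|c].
  rewrite /= uniq_rs andbT mem_cat negb_or; apply/andP; split.
    apply/negP => fz; have ik : index (f z) cs < k by rewrite index_mem.
    have /Hi/existsP[y] : index (f z) cs \in iota 0 k by rewrite mem_iota.
    rewrite inE nth_index // => /andP[/andP[_ /eqP fy] /Hf].
    by rewrite fy eqxx.
  apply/mapP => -[y]; rewrite mem_enum => /Hs/Hf/eqP; exact.
rewrite inE => /orP[/eqP->|]; last exact: in_t.
by rewrite mem_iota lt_f.
Qed.

(** Needed because classes decoded from variables agree with the intended ones only below [k]. *)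
Lemma special_coloring_ext (G : sgraph) k (X X' : nat -> {set G}) L t :
    (forall i, i < k -> X i = X' i) ->
  special_coloring k X L t = special_coloring k X' L t.
Proof.
move=> EX; have Esp : special k X = special k X'.
  by apply/setP => z; rewrite !inE; apply: eq_in_has => i; rewrite mem_iota => /EX->.
have Est : stuck k X L = stuck k X' L.
  apply/setP => z; rewrite /stuck /single Esp [LHS]in_set [RHS]in_set.
  do 2 congr (_ && _).
  by congr (_ && _); apply: eq_in_all => i; rewrite mem_iota => /EX->.
rewrite /special_coloring Est /single Esp; congr (_ && _).
by apply: eq_in_all => i; rewrite mem_iota => /EX->.
Qed.

(** * The chromatic number as a term *)

(* Variables 0, 1 and 2 are bound, variables 3 and 4 stand for the numbers s
   and t, the m variables from 5 on list the set D, and from 5 + m on there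
   are six variables for each of the k special colour classes. *)
Definition tD (m v : nat) : term := tHas (fun i => tEq v (5 + i)) m.
Definition tX (m i v : nat) : term := tHas (fun j => tEq v (5 + m + 6 * i + j)) 6.
Definition tL (m v : nat) : term :=
  tAnd (tNot (tD m v))
       (tLe (tCount 2 (tAnd (tNot (tD m 2)) (TAdj v 2))) (TVar 3)).
Definition tSpecial (m k v : nat) : term := tHas (fun i => tX m i v) k.
Definition tSingle (m k v : nat) : term :=
  tNot (TAdd (tSpecial m k v) (tL m v)).
Definition tAll (f : nat -> term) (k : nat) : term :=
  tNot (tHas (fun i => tNot (f i)) k).
Definition tStuck (m k : nat) : term :=
  tAnd (tL m 0) (tAnd (tNot (tSpecial m k 0))
    (tAnd (tAll (fun i => TSum 1 (tAnd (tX m i 1) (TAdj 0 1))) k)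
          (tNot (TSum 1 (tAnd (tSingle m k 1) (tNot (TAdj 0 1))))))).
Definition tIndep (f : nat -> term) : term :=
  tNot (TSum 0 (TSum 1 (tAnd (f 0) (tAnd (f 1) (TAdj 0 1))))).
Definition tSpecialColoring (m k : nat) : term :=
  tAnd (tAll (fun i => tIndep (tX m i)) k)
    (tAnd (tIndep (tL m))
       (tLe (TAdd (TAdd (TConst k) (tCount 0 (tSingle m k 0)))
                  (tNot (tNot (TSum 0 (tStuck m k))))) (TVar 4))).
(** The bounds 6 let [m] and [k] range from 0 to 5. Only variable 4 stays free. *)
Definition tColorable : term :=
  tHas (fun m => tHas (fun k =>
    tExs (3 :: iota 5 (m + 6 * k)) (tSpecialColoring m k)) 6) 6.
Definition tChi : term := TSum 4 (tNot tColorable).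

(** * Meaning of the formula under an assignment *)

Section Formula.
Variables (G : sgraph) (m k : nat).
Implicit Types e : nat -> G.

Definition setD_of e : {set G} := [set z | has (fun i => z == e (5 + i)) (iota 0 m)].
Definition setX_of e i : {set G} :=
  [set z | has (fun j => z == e (5 + m + 6 * i + j)) (iota 0 6)].
Definition setL_of e : {set G} := low (setD_of e) (enum_rank (e 3)).

Lemma holds_tD e v : holds e (tD m v) = (e v \in setD_of e).
Proof. by rewrite holds_has inE; apply: eq_has => i; rewrite holds_eq. Qed.

Lemma holds_tX e i v : holds e (tX m i v) = (e v \in setX_of e i).
Proof. by rewrite holds_has inE; apply: eq_has => j; rewrite holds_eq. Qed.

Lemma setD_assign e v x : v < 3 -> setD_of (assign e v x) = setD_of e.
Proof. by case: v => [|[|[|]]]. Qed.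

Lemma setX_assign e v x : v < 3 -> setX_of (assign e v x) = setX_of e.
Proof. by case: v => [|[|[|]]]. Qed.

Lemma setL_assign e v x : v < 3 -> setL_of (assign e v x) = setL_of e.
Proof. by case: v => [|[|[|]]]. Qed.

Lemma holds_tL e v : v < 2 -> holds e (tL m v) = (e v \in setL_of e).
Proof.
move=> v2; rewrite holds_and holds_not holds_tD holds_le gval_count.
rewrite /setL_of /low in_set; congr (andb _ (leq _ _)); apply: eq_card => y.
rewrite [LHS]in_set [RHS]in_set holds_and holds_not holds_tD setD_assign // holds_adj.
by rewrite /assign eqxx ltn_eqF.
Qed.

Lemma holds_tAll e f n : holds e (tAll f n) = all (fun i => holds e (f i)) (iota 0 n).
Proof.
rewrite holds_not holds_has -all_predC; apply: eq_all => i.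
by rewrite /= holds_not negbK.
Qed.

Lemma holds_tSpecial e v :
  holds e (tSpecial m k v) = (e v \in special k (setX_of e)).
Proof. by rewrite holds_has inE; apply: eq_has => i; rewrite holds_tX. Qed.

Lemma holds_tSingle e v : v < 2 ->
  holds e (tSingle m k v) = (e v \in single k (setX_of e) (setL_of e)).
Proof.
by move=> v2; rewrite holds_not holds_add holds_tSpecial holds_tL // in_setC in_setU.
Qed.

Lemma holds_tIndep e f (S : (nat -> G) -> {set G}) :
  (forall e v, v < 2 -> holds e (f v) = (e v \in S e)) ->
  (forall e v x, v < 2 -> S (assign e v x) = S e) ->
  holds e (tIndep f) = indep (S e).
Proof.
move=> Hf HS; rewrite holds_not holds_sum negb_exists.
apply/forallP/indepP => [H x y xS yS|H x]; last first.
  rewrite holds_sum negb_exists; apply/forallP => y.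
  rewrite !holds_and !Hf // !HS // holds_adj /assign /=.
  by apply/negP => /and3P[xS yS]; apply/negP; apply: H.
move: (H x); rewrite holds_sum negb_exists => /forallP/(_ y).
by rewrite !holds_and !Hf // !HS // holds_adj /assign /= xS yS.
Qed.

Lemma holds_tStuck e :
  holds e (tStuck m k) = (e 0 \in stuck k (setX_of e) (setL_of e)).
Proof.
rewrite holds_and holds_tL // holds_and holds_not holds_tSpecial holds_and holds_tAll.
rewrite [RHS]in_set.
do 3 congr (_ && _).
  apply: eq_all => i; rewrite holds_sum; apply: eq_existsb => y.
  by rewrite holds_and holds_tX setX_assign // holds_adj.
rewrite holds_not holds_sum negb_exists; apply: eq_forallb => y.
rewrite holds_and holds_tSingle // setX_assign // setL_assign // holds_not holds_adj.
by rewrite negb_and negbK -implybE.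
Qed.

Lemma holds_tSpecialColoring e : holds e (tSpecialColoring m k) =
  special_coloring k (setX_of e) (setL_of e) (enum_rank (e 4)).
Proof.
rewrite !holds_and holds_tAll /special_coloring; congr (_ && (_ && _)).
- apply: eq_all => i.
  apply: (@holds_tIndep _ _ (fun e => setX_of e i)) => [e' v _|e' v x v2].
    exact: holds_tX.
  by rewrite setX_assign // ltnW.
- apply: holds_tIndep => [e' v|e' v x v2]; first exact: holds_tL.
  by rewrite setL_assign // ltnW.
rewrite holds_le; congr (_ <= _).
have gval_add a b : gval e (TAdd a b) = gval e a + gval e b by [].
rewrite 2!gval_add gval_count gval_not holds_not negbK; congr (_ + _ + _).
  apply: eq_card => x; rewrite in_set holds_tSingle // setX_assign // setL_assign //.
congr (nat_of_bool _); rewrite holds_sum; apply/existsP/set0Pn => -[x].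
  by rewrite holds_tStuck setX_assign // setL_assign //; exists x.
by exists x; rewrite holds_tStuck setX_assign // setL_assign //.
Qed.

End Formula.

(** Any satisfying assignment describes a special colouring, hence a colouring. Conversely the
    near-split structure supplies [D], [s] and the classes, which are written into the variables. *)
Lemma holds_tColorable (G : sgraph) (e : nat -> G) : nearly_split G ->
  holds e tColorable = colorable G (enum_rank (e 4)).
Proof.
move=> [D [s [D5 sG Hcl Hind]]]; rewrite holds_has.
apply/hasP/idP => [[m _]|Hcol].
  rewrite holds_has => /hasP[k _ /holds_exs[e' [Ee]]].
  rewrite holds_tSpecialColoring Ee; last by rewrite inE mem_iota.
  exact: special_coloring_colorable.
have [k [X [k5 X6 HX]]] := colorable_special D5 Hcl Hind Hcol.
exists #|D|; first by rewrite mem_iota.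
rewrite holds_has; apply/hasP; exists k; first by rewrite mem_iota.
apply/holds_exs.
pose z0 := e 0.
(* A class with fewer than six vertices repeats its first vertex in the remaining variables; the
   class is nonempty, so the default [z0] never occurs. *)
pose pick_X i j := nth (head z0 (enum (X i))) (enum (X i)) j.
exists (fun v => if v == 3 then enum_val (Ordinal sG) else
  if v < 5 then e v else if v < 5 + #|D| then nth z0 (enum D) (v - 5) else
  if v < 5 + #|D| + 6 * k then
    pick_X ((v - (5 + #|D|)) %/ 6) ((v - (5 + #|D|)) %% 6) else e v).
split=> [v|].
  rewrite inE negb_or mem_iota => /andP[/negPf-> /negPf v5].
  case: ltnP => // lt5; rewrite lt5 /= in v5.
  by rewrite !ifF //; lia.
rewrite holds_tSpecialColoring; set e' := (fun v => _).
have -> : setL_of #|D| e' = low D s.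
  rewrite /setL_of /= enum_valK /=; congr low; apply/setP => z; rewrite inE.
  have Ed j : j < #|D| -> e' (5 + j) = nth z0 (enum D) j.
    move=> lt; rewrite /e'; case: eqP => [|_]; first by lia.
    case: ltnP => [|_]; first by lia.
    by case: ltnP => [_|]; [congr nth; lia | lia].
  apply/hasP/idP => [[i]|zD].
    rewrite mem_iota => /= iD /eqP->; rewrite Ed //.
    by rewrite -mem_enum mem_nth // -cardE.
  have lt : index z (enum D) < #|D| by rewrite cardE index_mem mem_enum.
  by exists (index z (enum D)); rewrite ?mem_iota // Ed // nth_index // mem_enum.
have EX i : i < k -> setX_of #|D| e' i = X i.
  move=> ik; have /andP[Xi0 Xi6] := X6 i ik.
  have Ee' j : j < 6 -> e' (5 + #|D| + 6 * i + j) = pick_X i j.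
    move=> j6; rewrite /e'; case: eqP => [|_]; first by lia.
    do 2 (case: ltnP => [|_]; first by lia).
    case: ltnP => [_|]; last by lia.
    have -> : 5 + #|D| + 6 * i + j - (5 + #|D|) = i * 6 + j by lia.
    by rewrite divnMDl // modnMDl divn_small // modn_small // addn0.
  apply/setP => z; rewrite inE; apply/hasP/idP => [[j]|zX].
    rewrite mem_iota => /= j6 /eqP->; rewrite Ee' // /pick_X -mem_enum.
    case: (ltnP j (size (enum (X i)))) => [|le]; first exact: mem_nth.
    rewrite nth_default //; move: Xi0; rewrite cardE.
    by case: (enum (X i)) => // y ys _; rewrite mem_head.
  have lt : index z (enum (X i)) < #|X i| by rewrite cardE index_mem mem_enum.
  exists (index z (enum (X i))); first by rewrite mem_iota; lia.
  by rewrite Ee' ?(leq_trans lt) // /pick_X nth_index // mem_enum.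
by rewrite (special_coloring_ext _ _ EX).
Qed.

(** G fails to be [t]-colourable exactly for [t] below [chi G], and all these [t] are ranks of
    vertices because [chi G] is at most |G|. *)
Lemma gval_tChi (G : sgraph) (e : nat -> G) : nearly_split G -> gval e tChi = chi G.
Proof.
move=> HG; rewrite gval_sum.
transitivity (\sum_(t < #|G|) (t < chi G)); last first.
  rewrite -[RHS](minn_idPr (chi_le_card G)).
  by elim: #|G| => [|n IHn]; rewrite ?big_ord0 ?min0n // big_ord_recr /= IHn; lia.
rewrite [RHS](reindex (@enum_rank G)) /=; last exact/onW_bij/enum_rank_bij.
apply: eq_bigr => x _; rewrite gval_not holds_tColorable // ltnNge chi_le.
by rewrite /assign eqxx.
Qed.

Lemma card_gt0_env (G : sgraph) (e : nat -> G) : 0 < #|G|.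
Proof. by apply/card_gt0P; exists (e 0). Qed.

Lemma nearly_split_1HNG (G : sgraph) : 0 < #|G| -> in_1HNG G ->
  nearly_split G /\ nearly_split (complement G).
Proof.
move=> G0 /in_1HNG_bound HG; split; first exact: NG_bound_nearly_split.
by apply: NG_bound_nearly_split => //; apply: NG_bound_complement.
Qed.

Theorem corollary6p5 :
  poly_time_on in_1HNG chi /\ poly_time_on in_1HNG theta.
Proof.
split.
  apply: (@poly_time_term _ _ tChi) => G e HG; apply: gval_tChi.
  by have [] := nearly_split_1HNG (card_gt0_env e) HG.
apply: (@poly_time_term _ _ (complement_term tChi)) => G e HG.
rewrite gval_complement; apply: gval_tChi.
by have [] := nearly_split_1HNG (card_gt0_env e) HG.
Qed.
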